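(* For every $M\in\mathbb N$ and every prime power $q$, for almost all $a\in(\mathbb F_q^M)^\infty$ (with respect to the uniform product (Haar) measure), $$\limsup_{n\to\infty}\frac{d_a(n)}{\log n}=\frac{1}{(M+1)\log q}\qquad\text{and}\qquad\liminf_{n\to\infty}\frac{d_a(n)}{\log n}=-\frac{1}{(M+1)\log q}.$$
   Context: Let $q$ be a prime power and $M\ge1$. For a multisequence $a=(a_{k,m})_{k\ge1,\,1\le m\le M}\in(\mathbb F_q^M)^\infty$ and $n\in\mathbb N_0$, the linear complexity $L_a(n)$ is the least $L\ge0$ such that there exist $c_1,\dots,c_L\in\mathbb F_q$ with $a_{k,m}=\sum_{i=1}^L c_i a_{k-i,m}$ for all $L<k\le n$ and all $1\le m\le M$ (a single linear feedback shift register of length $L$ generating the first $n$ terms of all $M$ sequences); $L_a(0)=0$. The linear complexity deviation is $d_a(n)=L_a(n)-\lceil nM/(M+1)\rceil$. *)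

(* Defs.v *)
From HB Require Import structures.
From mathcomp Require Import all_boot all_order all_algebra all_field.
From mathcomp Require Import all_classical all_reals all_analysis.
Set Implicit Arguments. Unset Strict Implicit. Unset Printing Implicit Defensive.
Import Order.TTheory GRing.Theory Num.Theory.

Section LinComp.
Variables (F : finFieldType) (M : nat).

(* A multisequence a = (a_{k,m}) is a : nat -> 'rV[F]_M, with
   a k = (a_{k+1,1}, ..., a_{k+1,M}) (0-based time index). *)
Definition multiseq := nat -> 'rV[F]_M.
HB.instance Definition _ := gen_eqMixin multiseq.
HB.instance Definition _ := gen_choiceMixin multiseq.
HB.instance Definition _ := isPointed.Build multiseq (fun _ => 0%R).

(* [lfsr_ok a n L] : some LFSR of length L (feedback coefficients c_1..c_L,
   here c i = c_{i+1}) generates the first n terms of all M sequences: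
   for all L < k <= n (1-based) i.e. L <= k < n (0-based), and all m,
   a_{k,m} = sum_{i=1}^L c_i a_{k-i,m}. *)
Definition lfsr_ok (a : multiseq) (n L : nat) : bool :=
  [exists c : {ffun 'I_L -> F},
     [forall k : 'I_n, (L <= k)%N ==>
        [forall m : 'I_M,
           a k ord0 m == (\sum_(i < L) c i * a (k - i.+1)%N ord0 m)%R]]].

Lemma lfsr_ok_n (a : multiseq) (n : nat) : exists L, lfsr_ok a n L.
Proof.
exists n; apply/existsP; exists [ffun=> 0%R]; apply/forallP => k.
by rewrite leqNgt ltn_ord.
Qed.

Definition lin_comp (a : multiseq) (n : nat) : nat :=
  ex_minn (lfsr_ok_n a n).

Definition ceil_frac (n : nat) : nat := ((n * M + M) %/ M.+1)%N.

Definition lc_dev (R : realType) (a : multiseq) (n : nat) : R :=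
  ((lin_comp a n)%:R - (ceil_frac n)%:R)%R.

Definition cylinder (w : seq 'rV[F]_M) : set multiseq :=
  [set a | forall i, (i < size w)%N -> a i = nth 0%R w i].

Definition cylinders : set (set multiseq) := [set cylinder w | w in setT].

Definition seqspace := g_sigma_algebraType cylinders.

End LinComp.

(* Main.v *)
(** Let q = #|F|.  The tails of L(n) come from counting: for a fixed register the
    first n letters satisfy n - L recurrences, and a failure L(n) > L forces a nonzero
    vector annihilating the block Hankel matrix of the sequence; each such event is a
    triangular system in the letters, so both P(d(n) > k) and P(d(n) < - k - 1) are at most
    q^(-(M+1)k).  Borel-Cantelli over geometric windows gives |d(n)| <= (1 + o(1))
    log_q n / (M+1).
    Conversely, a register fitting the first s letters predicts the next t columns with
    conditional probability q^(-Mt), and then L does not move while d drops by tM/(M+1).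
    Dually, a linear relation expressing one sequence through about s/(M+1) previous columns
    persists for t columns and then breaks with conditional probability q^(-t)(1 - 1/q),
    and then L(s+t+1) > sM/(M+1) + t up to O(1), i.e. d is about t/(M+1).  Near n = q^h there is
    room for q^(h - o(h)) independent attempts, so t can be taken close to h/M, respectively
    h, infinitely often. *)

Require Import Defs.
From HB Require Import structures.
From mathcomp Require Import all_boot all_order all_algebra all_field.
From mathcomp Require Import all_classical all_reals all_analysis.
From mathcomp Require Import ring lra zify.
Import Order.TTheory GRing.Theory Num.Theory.
Local Open Scope ring_scope.
Set Implicit Arguments.
Unset Strict Implicit.
Unset Printing Implicit Defensive.

Section LinearComplexityDeviation.
Local Open Scope classical_set_scope.

(** * Conditional probabilities of events decided by finitely many letters *)

Section Prob.
Variables (R : realType) (F : finFieldType) (M : nat).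
Local Notation A := 'rV[F]_M.
Local Notation Omega := (seqspace F M).
Variable P : probability Omega R.
Hypothesis hP : forall w : seq A,
  P (cylinder w) = ((#|F| ^ (M * size w))%:R^-1)%:E.

(** Invariance under changes after time [n] replaces the finite sub-sigma-algebra: measurability and
    the exact probability both follow by counting words of length [n]. *)
Definition determined (n : nat) (S : set Omega) :=
  forall a b : Omega, (forall i, (i < n)%N -> a i = b i) -> S a -> S b.

Definition pr (S : set Omega) : R := fine (P S).

Lemma determinedW m n S : (m <= n)%N -> determined m S -> determined n S.
Proof. by move=> mn h a b ab; apply: h => i im; apply: ab; exact: leq_trans mn. Qed.

Lemma determinedI n S T : determined n S -> determined n T -> determined n (S `&` T).
Proof. by move=> hS hT a b ab [] /(hS _ _ ab) ? /(hT _ _ ab). Qed.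

Lemma determinedC n S : determined n S -> determined n (~` S).
Proof. by move=> hS a b ab nS Sb; apply: nS; apply: hS Sb => i /ab. Qed.

Lemma measurable_cylinder (w : seq A) : measurable (cylinder w : set Omega).
Proof. by apply: sub_sigma_algebra; exists w. Qed.

Definition seqext (w : seq A) : Omega := fun i => nth 0 w i.
Definition initial_word n (a : Omega) : n.-tuple A := [tuple a i | i < n].

Lemma nth_initial_word n (a : Omega) i : (i < n)%N -> nth 0 (initial_word n a) i = a i.
Proof. by move=> lin; rewrite -[i]/(nat_of_ord (Ordinal lin)) nth_mktuple. Qed.

Lemma determined_cylinders n S : determined n S ->
  S = \bigcup_(w in [set w : n.-tuple A | S (seqext w)]) cylinder w.
Proof.
move=> dS; apply/seteqP; split=> [a Sa|a [w /= Sw]].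
  exists (initial_word n a) => /=.
    by apply: dS Sa => i ilt; rewrite /seqext nth_initial_word.
  by move=> i; rewrite size_tuple card_ord => ilt; rewrite nth_initial_word.
by rewrite /cylinder/= size_tuple => aw; apply: dS Sw => i /aw.
Qed.

Lemma determined_measurable n S : determined n S -> measurable S.
Proof.
move=> dS; rewrite (determined_cylinders dS); apply: fin_bigcup_measurable => //.
move=> w _; exact: measurable_cylinder.
Qed.

Lemma pr_cylinders (I : finType) (p : pred I) (W : I -> seq A) n :
  (forall i, size (W i) = n) -> injective W ->
  pr (\bigcup_(i in [set i | p i]) cylinder (W i)) = #|p|%:R / (#|F| ^ (M * n))%:R.
Proof.
move=> sW iW; rewrite /pr measure_fin_bigcup //.
- rewrite (eq_fsbigr (fun=> ((#|F| ^ (M * n))%:R^-1)%:E)); last first.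
    by move=> i _; rewrite -(sW i); exact: hP.
  rewrite -(bigfs _ (r := index_enum I) (P := p)) ?index_enum_uniq//; last first.
    by move=> i _; rewrite mem_index_enum.
  by rewrite sumEFin/= sumr_const mulr_natl.
- exact: finite_finset.
- move=> i j _ _ [a [ai aj]]; apply: iW; apply: (@eq_from_nth _ 0).
    by rewrite !sW.
  by move=> k; rewrite sW => kn; rewrite -ai ?sW// -aj ?sW.
- by move=> w _; exact: measurable_cylinder.
Qed.

Lemma pr_determined n S : determined n S ->
  pr S = #|[pred w : n.-tuple A | `[< S (seqext w) >]]|%:R / (#|F| ^ (M * n))%:R.
Proof.
move=> dS; rewrite -(@pr_cylinders _ _ (@tval n A)); last exact: val_inj.
  by rewrite {1}(determined_cylinders dS); congr (pr (\bigcup_(i in _) _));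
    apply/seteqP; split=> w /= Sw; apply/asboolP.
by move=> i; rewrite size_tuple.
Qed.

Definition upd (a : Omega) k (x : A) : Omega := fun i => if i == k then x else a i.

(** A word of length [s.+1] is a prefix followed by one letter; each prefix in [S] has exactly [e]
    admissible letters, so the count factors. The conditional probabilities below all rest on this
    count. *)
Lemma pr_step s S Q e : determined s S -> determined s.+1 Q ->
  (forall a : Omega, #|[pred x : A | `[< Q (upd a s x) >]]| = e) ->
  pr (S `&` Q) = pr S * (e%:R / (#|F| ^ M)%:R).
Proof.
move=> dS dQ he; rewrite (pr_determined dS).
pose W (u : s.-tuple A * A) := rcons u.1 u.2.
pose p := [pred u : s.-tuple A * A | `[< S (seqext u.1) >] && `[< Q (seqext (W u)) >]].
have -> : S `&` Q = \bigcup_(u in [set u | p u]) cylinder (W u).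
  have agr u a : cylinder (W u) a -> forall i, (i < s.+1)%N -> seqext (W u) i = a i.
    by move=> ca i ilt; rewrite ca// size_rcons size_tuple.
  have agr' (u : s.-tuple A * A) i : (i < s)%N -> seqext (W u) i = seqext u.1 i.
    by move=> ilt; rewrite /seqext nth_rcons size_tuple ilt.
  apply/seteqP; split=> [a [Sa Qa]|a [u /= /andP[/asboolP Su /asboolP Qu] ca]].
    have ca : cylinder (W (initial_word s a, a s)) a.
      move=> i; rewrite size_rcons size_tuple ltnS leq_eqVlt nth_rcons size_tuple.
      by case/predU1P => [->|il]; rewrite ?ltnn ?eqxx// il nth_initial_word.
    exists (initial_word s a, a s) => //=; apply/andP; split; apply/asboolP.
      apply: dS Sa => i il; rewrite -(agr _ _ ca i (ltnW il)).
      exact: (agr' (initial_word s a, a s)).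
    by apply: dQ Qa => i il; rewrite -(agr _ _ ca).
  split; last exact: dQ (agr u a ca) Qu.
  by apply: dS Su => i il; rewrite -(agr u a ca i (ltnW il)) agr'.
rewrite (pr_cylinders _ (n := s.+1)).
- rewrite mulf_div -!natrM -expnD -mulnSr; congr (_%:R / _).
  rewrite -!sum1_card.
  rewrite (eq_bigl (fun u : s.-tuple A * A => `[< S (seqext u.1) >] && `[< Q (seqext (W u)) >]))//.
  rewrite -(pair_big_dep (fun w : s.-tuple A => `[< S (seqext w) >])
    (fun w x => `[< Q (seqext (W (w, x))) >]) (fun _ _ => 1%N))/=.
  rewrite big_distrl/=; apply: eq_bigr => w _; rewrite mul1n.
  rewrite -(he (seqext w)) -sum1_card; apply: eq_bigl => x.
  rewrite inE; apply/asboolP/asboolP; apply: dQ => i; rewrite 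
    ltnS leq_eqVlt /upd /seqext /W nth_rcons size_tuple;
    by case/predU1P => [->|il]; rewrite ?ltnn ?eqxx// il; case: eqP il => // ->; rewrite ltnn.
- by move=> u; rewrite size_rcons size_tuple.
- move=> [u x] [v y] /= /rcons_inj [/val_inj -> ->]//.
Qed.

(** * Elementary rules for real-valued probabilities *)

Lemma pr_setT : pr setT = 1.
Proof. by rewrite /pr probability_setT. Qed.

Lemma pr_set0 : pr set0 = 0.
Proof. by rewrite /pr measure0. Qed.

Lemma pr_ge0 S : 0 <= pr S.
Proof. by rewrite fine_ge0. Qed.

Lemma pr_EFin S : measurable S -> P S = (pr S)%:E.
Proof. by move=> mS; rewrite /pr fineK// fin_num_measure. Qed.

Lemma le_pr S T : measurable S -> measurable T -> S `<=` T -> pr S <= pr T.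
Proof.
by move=> mS mT ST; rewrite -lee_fin -!pr_EFin//; apply: le_measure; rewrite ?inE.
Qed.

Lemma pr_setIC S T : measurable S -> measurable T ->
  pr (S `&` ~` T) = pr S - pr (S `&` T).
Proof.
move=> mS mT; have mST := measurableI _ _ mS mT.
have mSCT := measurableD mS mT.
apply/eqP; rewrite eq_sym subr_eq -eqe EFinD -!pr_EFin//.
by rewrite -[S `&` ~` T]/(S `\` T) -(measureDI P mS mT).
Qed.

Lemma pr_bigcup (I : finType) (S : I -> set Omega) :
  (forall i, measurable (S i)) -> pr (\bigcup_i S i) <= \sum_i pr (S i).
Proof.
move=> mS; rewrite -lee_fin -sumEFin -pr_EFin; last first.
  by apply: fin_bigcup_measurable => //; exact: finite_finset.
under eq_bigr do rewrite -pr_EFin//.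
have -> : (\sum_i P (S i) = \sum_(i \in [set: I]) P (S i))%E.
  rewrite (bigfs _ (r := index_enum I) (P := predT)) ?index_enum_uniq//.
    by congr (\big[_/_]_(i \in _) _); apply/seteqP; split.
  by move=> i _; rewrite mem_index_enum.
apply: content_sub_fsum => //.
- exact: finite_finset.
- by apply: fin_bigcup_measurable => //; exact: finite_finset.
Qed.

(* E is decided by the letters in positions [s, e) given the first s letters,
   and has conditional probability p whatever these are. *)
Definition blk s e (E : set Omega) (p : R) :=
  [/\ (s <= e)%N, determined e E & forall S, determined s S -> pr (S `&` E) = pr S * p].

Lemma blk_pr s e E p : blk s e E p -> pr E = p.
Proof. by case=> _ _ /(_ setT (fun _ _ _ => id)); rewrite setTI pr_setT mul1r. Qed.

Lemma blkT s : blk s s setT 1.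
Proof. by split=> // S _; rewrite setIT mulr1. Qed.

Lemma blkI s m e E E' p p' :
  blk s m E p -> blk m e E' p' -> blk s e (E `&` E') (p * p').
Proof.
move=> [sm dE hE] [me dE' hE']; split; first exact: leq_trans me.
  by apply: determinedI => //; exact: determinedW dE.
by move=> S dS; rewrite setIA hE' ?hE ?mulrA//; apply: determinedI => //; exact: determinedW dS.
Qed.

Lemma blkC s e E p : blk s e E p -> blk s e (~` E) (1 - p).
Proof.
move=> [se dE hE]; split=> //; first exact: determinedC.
move=> S dS; rewrite pr_setIC ?hE ?mulrBr ?mulr1//.
  exact: determined_measurable dS.
exact: determined_measurable dE.
Qed.

Lemma blk_iter (t : nat -> nat) (E : nat -> set Omega) p J :
  (forall j, (j < J)%N -> blk (t j) (t j.+1) (E j) p) ->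
  blk (t 0%N) (t J) (\bigcap_(j < J) E j) (p ^+ J).
Proof.
elim: J => [|J IH] hE.
  by rewrite bigcap_mkord big_ord0; exact: blkT.
rewrite bigcap_mkord big_ord_recr/= -bigcap_mkord exprSr.
by apply: blkI (hE _ _) => //; apply: IH => j /leqW/hE.
Qed.

(** If no attempt succeeds, then either every [E j] fails, with probability (1 - p)^J, or some [E j]
    occurs while [G j] fails. Since [G j] is decided before block [j] starts, the latter costs p * g
    and not merely g, which keeps the sum small even when [J] is of order 1/p. *)
Lemma blk_window (t : nat -> nat) (E G : nat -> set Omega) p g J : 0 <= p ->
  (forall j, (j < J)%N -> blk (t j) (t j.+1) (E j) p) ->
  (forall j, (j < J)%N -> determined (t j) (G j)) ->
  (forall j, (j < J)%N -> pr (~` G j) <= g) ->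
  pr (\bigcap_(j < J) ~` (E j `&` G j)) <= (1 - p) ^+ J + J%:R * (p * g).
Proof.
move=> p0 hE dG hG.
have dE j : (j < J)%N -> determined (t j.+1) (E j) by move=> /hE[].
have dG' j : (j < J)%N -> determined (t j.+1) (G j).
  by move=> jJ; case: (hE _ jJ) => tt _ _; exact: determinedW (dG _ jJ).
have mEC : measurable (\bigcap_(j < J) ~` E j).
  by apply: bigcap_measurableType => j jJ; exact: determined_measurable (determinedC (dE _ jJ)).
have mGC (j : 'I_J) : measurable (~` G j `&` E j).
  apply: determined_measurable (determinedI (determinedC (dG' _ (ltn_ord j)))
    (dE _ (ltn_ord j))).
pose B := \bigcup_(j : 'I_J) (~` G j `&` E j).
have mB : measurable B.
  by apply: fin_bigcup_measurable => //; exact: finite_finset.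
have mW : measurable (\bigcap_(j < J) ~` (E j `&` G j)).
  apply: bigcap_measurableType => j jJ.
  exact: determined_measurable (determinedC (determinedI (dE _ jJ) (dG' _ jJ))).
apply: (@le_trans _ _ (pr ((\bigcap_(j < J) ~` E j) `|` B))).
  apply: le_pr => //; first exact: measurableU.
  move=> a ha; have [[j jJ]|nB] := pselect (exists2 j, (j < J)%N & E j a).
    move=> Ej; right; exists (Ordinal jJ) => //; split => // Gj.
    by apply: (ha j jJ).
  by left=> j jJ Ej; apply: nB; exists j.
apply: (@le_trans _ _ (pr (\bigcap_(j < J) ~` E j) + pr B)).
  rewrite -lee_fin EFinD -!pr_EFin//; last exact: measurableU.
  exact: measureU2.
apply: lerD.
  have /blk_iter/blk_pr-> // : forall j, (j < J)%N -> blk (t j) (t j.+1) (~` E j) (1 - p).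
  by move=> j /hE; exact: blkC.
apply: le_trans (pr_bigcup mGC) _.
rewrite mulr_natl -[X in _ *+ X]card_ord -sumr_const; apply: ler_sum => j _.
have [_ _ ->] := hE _ (ltn_ord j); last exact: determinedC (dG _ (ltn_ord j)).
by rewrite mulrC ler_wpM2l// hG.
Qed.

(** Translations by multiples of a row on which the form takes the value 1 permute the fibres
    transitively, so all of them have the same size. *)
Lemma card_row_linear_fiber (v : 'I_M -> F) (c : F) (m0 : 'I_M) : v m0 != 0 ->
  (#|[pred x : A | (\sum_m v m * x ord0 m == c)%R]| * #|F| = #|F| ^ M)%N.
Proof.
move=> v0; pose phi (x : A) := \sum_m v m * x ord0 m.
pose x1 : A := \row_m ((m == m0)%:R / v m0).
have phi1 (x : A) d : phi (x + d *: x1) = phi x + d.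
  rewrite /phi -[d in RHS](mulfK v0) (mulrC d) -mulrA.
  rewrite [X in _ = _ + X](_ : _ = \sum_m v m * (d *: x1) ord0 m).
    by rewrite -big_split; apply: eq_bigr => m _; rewrite !mxE mulrDr.
  rewrite (bigD1 m0)//= big1 ?addr0 => [|m /negPf mm0].
    by rewrite !mxE eqxx mul1r.
  by rewrite !mxE mm0 mul0r !mulr0.
have -> : (#|F| ^ M = #|{: A}|)%N by rewrite card_mx mul1n.
rewrite mulnC -sum_nat_const -[RHS]sum1_card (partition_big phi predT)//=.
apply: eq_big => // c' _; rewrite -sum1_card.
rewrite (reindex_inj (@addrI _ ((c - c') *: x1)))/=; apply: eq_bigl => x.
rewrite !inE -/(phi _) [_ + x]addrC phi1 addrCA -[X in _ == X]addr0.
by rewrite (inj_eq (@addrI _ c)) subr_eq0.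
Qed.

Lemma blk_letter s (f : Omega -> A) :
  (forall a b : Omega, (forall i, (i < s)%N -> a i = b i) -> f a = f b) ->
  blk s s.+1 [set a | a s = f a] ((#|F| ^ M)%:R^-1).
Proof.
move=> hf; have dQ : determined s.+1 [set a | a s = f a].
  by move=> a b ab /=; rewrite -ab// => ->; apply: hf => i il; rewrite ab// ltnW.
split=> // S dS; rewrite (pr_step dS dQ (e := 1)) ?mul1r// => a.
apply: etrans (card1 (f a)); apply: eq_card => x; rewrite !inE /=.
have -> : f (upd a s x) = f a.
  by apply: hf => i il; rewrite /upd ltn_eqF.
by rewrite /upd eqxx; apply/asboolP/eqP.
Qed.

Lemma blk_linear s (v : 'I_M -> F) (m0 : 'I_M) (beta : Omega -> F) : v m0 != 0 ->
  (forall a b : Omega, (forall i, (i < s)%N -> a i = b i) -> beta a = beta b) ->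
  blk s s.+1 [set a : Omega | \sum_m v m * a s ord0 m = beta a] (#|F|%:R^-1).
Proof.
move=> v0 hb; have dQ : determined s.+1 [set a : Omega | \sum_m v m * a s ord0 m = beta a].
  by move=> a b ab /=; rewrite -ab// => ->; apply: hb => i il; rewrite ab// ltnW.
have F0 : (#|F|%:R : R) != 0 by rewrite pnatr_eq0 -lt0n; apply/card_gt0P; exists 0.
split=> // S dS.
rewrite (pr_step dS dQ (e := #|[pred x : A | \sum_m v m * x ord0 m == 0]|)).
  rewrite -(card_row_linear_fiber 0 v0) natrM; congr (_ * _).
  rewrite invfM mulrA divff ?mul1r// pnatr_eq0 -lt0n; apply/card_gt0P; exists 0.
  by rewrite inE big1// => m _; rewrite mxE mulr0.
move=> a; apply/eqP; have F0' : (0 < #|F|)%N by apply/card_gt0P; exists 0.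
rewrite -(eqn_pmul2r F0') (card_row_linear_fiber 0 v0).
rewrite -(card_row_linear_fiber (beta a) v0) eqn_pmul2r//; apply/eqP/eq_card => x.
rewrite !inE/=; have -> : beta (upd a s x) = beta a.
  by apply: hb => i il; rewrite /upd ltn_eqF.
by rewrite /upd eqxx; apply/asboolP/eqP.
Qed.
End Prob.

(** * Linear feedback registers and Hankel systems *)

(** A trivial kernel means full column rank, hence the rows span the whole space. Arbitrary finite
    index types allow pairs (column, sequence) as indices. *)
Lemma linear_system_solvable (F : fieldType) (I J : finType) (B : I -> J -> F) :
  (forall v : J -> F, (forall i, \sum_j B i j * v j = 0) -> forall j, v j = 0) ->
  forall y : J -> F, exists c : I -> F, forall j, \sum_i c i * B i j = y j.
Proof.
move=> hB y; pose X := \matrix_(i < #|I|, j < #|J|) B (enum_val i) (enum_val j).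
have sumI (G : I -> F) : \sum_i G i = \sum_(i < #|I|) G (enum_val i).
  by rewrite -big_enum_val; apply: eq_bigl => i; rewrite inE.
have sumJ (G : J -> F) : \sum_j G j = \sum_(j < #|J|) G (enum_val j).
  by rewrite -big_enum_val; apply: eq_bigl => j; rewrite inE.
have fullX : row_full X.
  rewrite /row_full -mxrank_tr -/(row_free X^T) -kermx_eq0; apply/eqP/row_matrixP => k.
  have /sub_kermxP := row_sub k (kermx X^T).
  move: (row k _) => w /matrixP wX; rewrite row0.
  have w0 : forall j, w ord0 (enum_rank j) = 0.
    apply: hB => i; have := wX ord0 (enum_rank i); rewrite !mxE; apply: etrans.
    by rewrite sumJ; apply: eq_bigr => j _; rewrite !mxE !enum_rankK enum_valK mulrC.
  apply/matrixP => i j; rewrite !mxE ord1 -[j]enum_valK; exact: w0.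
have /submxP[D /matrixP hD] := submx_full (\row_j y (enum_val j)) fullX.
exists (fun i => D ord0 (enum_rank i)) => j.
have := hD ord0 (enum_rank j); rewrite !mxE enum_rankK => ->.
by rewrite sumI; apply: eq_bigr => i _; rewrite !mxE enum_rankK enum_valK.
Qed.

Section LFSR.
Variables (F : finFieldType) (M : nat).
Local Notation A := 'rV[F]_M.
Implicit Type a : multiseq F M.

Definition predicts a L (c : 'I_L -> F) k : Prop :=
  forall m : 'I_M, a k ord0 m = \sum_(i < L) c i * a (k - i.+1)%N ord0 m.

Lemma lfsr_okP a n L :
  reflect (exists c : {ffun 'I_L -> F}, forall k, (L <= k < n)%N -> predicts a c k)
          (lfsr_ok a n L).
Proof.
apply: (iffP existsP) => -[c hc]; exists c.
  move=> k /andP[Lk kn] m; move/forallP: hc => /(_ (Ordinal kn)).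
  by move/implyP/(_ Lk)/forallP/(_ m)/eqP.
apply/forallP => k; apply/implyP => Lk; apply/forallP => m; apply/eqP.
by apply: hc; rewrite Lk /=.
Qed.

Lemma lfsr_okW a n L L' : (L <= L')%N -> lfsr_ok a n L -> lfsr_ok a n L'.
Proof.
move=> LL' /lfsr_okP[c hc]; apply/lfsr_okP.
pose c' (i : nat) : F := if insub i is Some j then c j else 0.
exists [ffun i : 'I_L' => c' i].
move=> k /andP[L'k kn] m; rewrite hc; last by rewrite (leq_trans LL' L'k).
transitivity (\sum_(i < L) c' i * a (k - i.+1)%N ord0 m).
  by apply: eq_bigr => i _; rewrite /c' valK.
rewrite (big_ord_widen L' (fun i => c' i * a (k - i.+1)%N ord0 m))//.
rewrite big_mkcond/=; apply: eq_bigr => i _; rewrite ffunE.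
by rewrite /c'; case: insubP => [j -> //|/negPf->]; rewrite mul0r.
Qed.

(** Padding a register with zero taps makes the admissible lengths an up-set, so the minimum acts as
    a threshold and both tails concern one length [L]. *)
Lemma lfsr_ok_lin_comp a n L : lfsr_ok a n L = (lin_comp a n <= L)%N.
Proof.
rewrite /lin_comp; case: ex_minnP => m okm hm; apply/idP/idP; first exact: hm.
by move=> mL; exact: lfsr_okW okm.
Qed.

Lemma predicts_agree a b L (c : 'I_L -> F) k :
  (forall i, (i <= k)%N -> a i = b i) -> predicts a c k -> predicts b c k.
Proof.
move=> ab pk m; rewrite -ab// pk; apply: eq_bigr => i _.
by rewrite ab// leq_subr.
Qed.

Lemma lfsr_ok_agree a b n L : (forall i, (i < n)%N -> a i = b i) ->
  lfsr_ok a n L -> lfsr_ok b n L.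
Proof.
move=> ab /lfsr_okP[c hc]; apply/lfsr_okP; exists c => k /[dup] /andP[Lk kn] /hc.
by apply: predicts_agree => i ik; rewrite ab// (leq_ltn_trans ik).
Qed.

(** The feedback coefficients solve a linear system whose matrix is the block Hankel matrix with L
    rows; if its kernel were trivial, the system would be solvable. *)
Lemma not_lfsr_ok_annihilator a n L : (L <= n)%N -> ~~ lfsr_ok a n L ->
  exists2 v : {ffun 'I_(n - L) * 'I_M -> F}, v != [ffun=> 0] &
    forall r, (r < L)%N -> \sum_u v u * a (r + u.1)%N ord0 u.2 = 0.
Proof.
move=> Ln; apply: contraNP => nv; apply/lfsr_okP.
(* At time L + u, coefficient i multiplies the letter at L + u - i - 1, that is, Hankel row L - 1 -
   i; hence the reversal. *)
pose B (i : 'I_L) (u : 'I_(n - L) * 'I_M) := a (rev_ord i + u.1)%N ord0 u.2.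
have [v vB|c hc] := @linear_system_solvable _ _ _ B _ (fun u => a (L + u.1)%N ord0 u.2).
  move=> j; apply/eqP; apply: contra_notT nv => vj.
  exists [ffun u => v u].
    by apply: contraNneq vj => /ffunP/(_ j); rewrite !ffunE => ->.
  move=> r rL; rewrite -[RHS](vB (rev_ord (Ordinal rL))) /B rev_ordK.
  by apply: eq_bigr => u _; rewrite ffunE mulrC.
exists [ffun i => c i] => k /andP[Lk kn] m.
have kL : (k - L < n - L)%N by rewrite ltn_sub2r// (leq_ltn_trans Lk).
have /= := hc (Ordinal kL, m); rewrite subnKC// => <-.
apply: eq_bigr => i _; rewrite ffunE /B/=; congr (_ * a _ _ _).
by have := ltn_ord i; lia.
Qed.

(* A linear relation expressing the first sequence through the D previous columns,
   when it holds for L consecutive columns and fails at the next one, cannot be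
   compatible with a recurrence of order L. *)
Lemma not_lfsr_ok_relation a D L (v : 'I_D * 'I_M -> F) (m0 : 'I_M) :
  let X r := a (r + D)%N ord0 m0 - \sum_u v u * a (r + u.1)%N ord0 u.2 in
  (forall r, (r < L)%N -> X r = 0) -> X L <> 0 -> ~~ lfsr_ok a (L + D).+1 L.
Proof.
move=> X X0; apply: contra_notN => /lfsr_okP[c hc].
(* Being a fixed combination of shifts of the sequences, [X] inherits their recurrence, which would
   make [X L] a combination of zeros. *)
suff -> : X L = \sum_(i < L) c i * X (L - i.+1)%N.
  by rewrite big1// => i _; rewrite X0 ?mulr0//; have := ltn_ord i; lia.
rewrite /X hc; last by lia.
under [RHS]eq_bigr do rewrite mulrBr.
rewrite sumrB; congr (_ - _).
  by apply: eq_bigr => i _; congr (_ * a _ _ _); have := ltn_ord i; lia.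
under [RHS]eq_bigr do rewrite mulr_sumr.
rewrite exchange_big/=; apply: eq_bigr => u _.
rewrite hc; last by have := ltn_ord u.1; lia.
rewrite mulr_sumr; apply: eq_bigr => i _; rewrite mulrCA; congr (_ * (_ * a _ _ _)).
by have := ltn_ord i; lia.
Qed.

(** Linear dependence of the K rows of the block Hankel matrix with D block columns. *)
Definition degenerate a K D := exists2 c : {ffun 'I_K -> F}, c != [ffun=> 0] &
  forall u, (u < D)%N -> forall m, \sum_r c r * a (r + u)%N ord0 m = 0.

(** With independent rows, the D * M columns span the space of vectors of length K, so the next
    column of sequence [m0] is a combination of them. *)
Lemma relation_exists a K D (m0 : 'I_M) : ~ degenerate a K D ->
  exists v : {ffun 'I_D * 'I_M -> F}, forall r, (r < K)%N ->
    a (r + D)%N ord0 m0 - \sum_u v u * a (r + u.1)%N ord0 u.2 = 0.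
Proof.
move=> nd; pose B (u : 'I_D * 'I_M) (r : 'I_K) := a (r + u.1)%N ord0 u.2.
have [c hc|v hv] := @linear_system_solvable _ _ _ B _ (fun r => a (r + D)%N ord0 m0).
  move=> j; apply/eqP; apply: contra_notT nd => cj; exists [ffun r => c r].
    by apply: contraNneq cj => /ffunP/(_ j); rewrite !ffunE => ->.
  move=> u uD m; rewrite -[RHS](hc (Ordinal uD, m)); apply: eq_bigr => r _.
  by rewrite ffunE mulrC.
exists [ffun u => v u] => r rK; rewrite -(hv (Ordinal rK)) -sumrB big1// => u _.
by rewrite ffunE subrr.
Qed.
End LFSR.

(** * Probability bounds *)

Section Bounds.
Variables (R : realType) (F : finFieldType) (M : nat).
Local Notation A := 'rV[F]_M.
Local Notation Omega := (seqspace F M).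
Variable P : probability Omega R.
Hypothesis hP : forall w : seq A,
  P (cylinder w) = ((#|F| ^ (M * size w))%:R^-1)%:E.
Local Notation pr := (pr P).
Local Notation blk := (blk P).
Local Notation q := #|F|.

Lemma card_F_gt0 : (0 < q)%N.
Proof. by apply/card_gt0P; exists 0. Qed.

Lemma determined_lfsr_ok n L : determined n [set a : Omega | lfsr_ok a n L].
Proof. by move=> a b ab; exact: lfsr_ok_agree. Qed.

Lemma blk_iter_shift s J (E : nat -> set Omega) p :
  (forall j, (j < J)%N -> blk (s + j) (s + j).+1 (E j) p) ->
  blk s (s + J) (\bigcap_(j < J) E j) (p ^+ J).
Proof.
move=> hE; rewrite -{1}[s]addn0; apply: (@blk_iter _ _ _ _ (addn s)) => j jJ.
by rewrite addnS; exact: hE.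
Qed.

Lemma predictsE L (c : 'I_L -> F) k (a : Omega) :
  predicts a c k <-> a k = \row_m \sum_(i < L) c i * a (k - i.+1)%N ord0 m.
Proof.
split=> [h|h m]; last by rewrite h mxE.
by apply/rowP => m; rewrite mxE h.
Qed.

(** The register may be chosen from the first [s] letters; each correct prediction then prescribes
    one whole letter from its past. *)
Lemma blk_predicts L s t (c : Omega -> 'I_L -> F) : (L <= s)%N ->
  (forall a b : Omega, (forall i, (i < s)%N -> a i = b i) -> c a = c b) ->
  blk s (s + t) (\bigcap_(j < t) [set a : Omega | predicts a (c a) (s + j)])
    ((q ^ M)%:R^-1 ^+ t).
Proof.
move=> Ls hc; apply: blk_iter_shift => j _.
have -> : [set a : Omega | predicts a (c a) (s + j)] =
    [set a | a (s + j)%N = \row_m \sum_(i < L) c a i * a (s + j - i.+1)%N ord0 m].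
  by apply/seteqP; split=> a /= /predictsE.
apply: blk_letter => // a b ab; apply/rowP => m; rewrite !mxE.
rewrite (hc a b) => [|i ils]; last by rewrite ab// (leq_trans ils)// leq_addr.
by apply: eq_bigr => i _; rewrite ab//; have := ltn_ord i; lia.
Qed.

(** Union bound over the q^L registers, each of which dictates n - L letters. *)
Lemma pr_lfsr_ok n L : (L <= n)%N ->
  pr [set a : Omega | lfsr_ok a n L] <= (q ^ L)%:R * (q ^ M)%:R^-1 ^+ (n - L).
Proof.
move=> Ln; pose S (c : {ffun 'I_L -> F}) :=
  \bigcap_(j < n - L) [set a : Omega | predicts a c (L + j)].
have bS c : blk L (L + (n - L)) (S c) ((q ^ M)%:R^-1 ^+ (n - L)).
  exact: (@blk_predicts L L (n - L) (fun=> c)).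
have mS c : measurable (S c) by have [_ d _] := bS c; exact: determined_measurable d.
apply: (@le_trans _ _ (pr (\bigcup_c S c))).
  apply: le_pr.
  - exact: determined_measurable (@determined_lfsr_ok n L).
  - by apply: fin_bigcup_measurable => //; exact: finite_finset.
  move=> a /lfsr_okP[c hc]; exists c => // j jnL; apply: hc.
  by rewrite leq_addr -ltn_subRL.
apply: le_trans (pr_bigcup _ mS) _.
rewrite (eq_bigr (fun=> (q ^ M)%:R^-1 ^+ (n - L))) => [|c _]; last exact: blk_pr (bS c).
by rewrite sumr_const mulr_natl card_ffun card_ord.
Qed.

(** Union bound over possible annihilators [v]. If [k] is the last column where [v] is nonzero,
    equation r is a nontrivial affine condition on the letter at k + r given the earlier letters, so
    the L equations form a triangular system, each holding with probability 1/q. *)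
Lemma pr_not_lfsr_ok n L : (L <= n)%N ->
  pr [set a : Omega | ~~ lfsr_ok a n L] <= (q ^ (M * (n - L)))%:R * q%:R^-1 ^+ L.
Proof.
move=> Ln; pose T := {ffun 'I_(n - L) * 'I_M -> F}.
(* The zero vector gets the empty event, so one bound serves every term of the union. *)
pose S (v : T) := if v == [ffun=> 0] then set0 else
  \bigcap_(r < L) [set a : Omega | \sum_u v u * a (r + u.1)%N ord0 u.2 = 0].
have S_ub v : measurable (S v) /\ pr (S v) <= q%:R^-1 ^+ L.
  rewrite /S; case: eqP => [_|/eqP v0].
    by split=> //; rewrite pr_set0 exprn_ge0// invr_ge0 ler0n.
  have [u0 vu0] : exists u, v u != 0.
    apply/existsP; apply: contraNT v0 => /existsPn h; apply/eqP/ffunP => u.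
    by rewrite ffunE; apply/eqP; rewrite -[_ == _]negbK.
  have [[k m0] /= vk hk] := @arg_maxnP _ u0 (fun u => v u != 0) (fun u => u.1 : nat) vu0.
  have bS : blk k (k + L) (\bigcap_(r < L) [set a : Omega |
      \sum_u v u * a (r + u.1)%N ord0 u.2 = 0]) (q%:R^-1 ^+ L).
    apply: blk_iter_shift => r rL.
    rewrite (_ : [set _ | _] = [set a : Omega | \sum_m v (k, m) * a (k + r)%N ord0 m =
        - \sum_(u : 'I_(n - L) * 'I_M | (u.1 < k)%N) v u * a (r + u.1)%N ord0 u.2]).
      apply: (@blk_linear _ _ _ _ hP _ (fun m => v (k, m)) m0) => // a b ab; congr (- _).
      by apply: eq_bigr => u uk; rewrite ab// addnC ltn_add2r.
    have E (a : Omega) : \sum_u v u * a (r + u.1)%N ord0 u.2 =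
        \sum_m v (k, m) * a (k + r)%N ord0 m +
        \sum_(u : 'I_(n - L) * 'I_M | (u.1 < k)%N) v u * a (r + u.1)%N ord0 u.2.
      rewrite (bigID (fun u : 'I_(n - L) * 'I_M => u.1 < k)%N)/= addrC; congr (_ + _).
      rewrite (bigID (fun u : 'I_(n - L) * 'I_M => u.1 == k))/= [X in _ + X]big1 ?addr0.
        rewrite (reindex (fun m => (k, m))) => [|/=].
          by apply: eq_big => [m|m _]; rewrite /= ?ltnn ?eqxx// addnC.
        exists snd => [//|[u m]]; rewrite inE /= => /andP[_ /eqP->]//.
      move=> u /andP[uk nuk]; case: (altP (v u =P 0)) => [->|/hk]; rewrite ?mul0r//=.
      by move=> ku; case/negP: nuk; rewrite -val_eqE /=; lia.
    apply/seteqP; split=> a /=; rewrite E; last by move=> ->; rewrite addNr.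
    by move/eqP; rewrite addr_eq0 => /eqP.
  split; first by have [_ d _] := bS; exact: determined_measurable d.
  by rewrite (blk_pr bS).
apply: (@le_trans _ _ (pr (\bigcup_v S v))).
  apply: le_pr.
  - apply: (@determined_measurable _ _ n) => a b ab; apply: contra.
    by apply: lfsr_ok_agree => i /ab.
  - by apply: fin_bigcup_measurable => [|v _]; [exact: finite_finset|have [] := S_ub v].
  move=> a /(not_lfsr_ok_annihilator Ln)[v v0 hv]; exists v => //.
  by rewrite /S (negPf v0).
apply: le_trans (pr_bigcup _ (fun v => (S_ub v).1)) _.
apply: (@le_trans _ _ (\sum_(v : T) q%:R^-1 ^+ L)).
  by apply: ler_sum => v _; have [] := S_ub v.
by rewrite sumr_const mulr_natl card_ffun card_prod !card_ord mulnC.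
Qed.

Lemma determined_degenerate K D : determined (K + D) [set a : Omega | degenerate a K D].
Proof.
move=> a b ab [c c0 hc]; exists c => // u uD m; rewrite -[RHS](hc u uD m).
by apply: eq_bigr => r _; rewrite ab//; have := ltn_ord r; lia.
Qed.

(** The system is triangular again, now ordered by the last nonzero row coefficient [k]. The same
    scalars act on all M sequences, so equation u fixes the entire letter at k + u and has
    conditional probability q^(-M). *)
Lemma pr_degenerate K D :
  pr [set a : Omega | degenerate a K D] <= (q ^ K)%:R * (q ^ M)%:R^-1 ^+ D.
Proof.
pose T := {ffun 'I_K -> F}.
pose S (c : T) := if c == [ffun=> 0] then set0 else
  \bigcap_(u < D) [set a : Omega | forall m, \sum_r c r * a (r + u)%N ord0 m = 0].
have S_ub c : measurable (S c) /\ pr (S c) <= (q ^ M)%:R^-1 ^+ D.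
  rewrite /S; case: eqP => [_|/eqP c0].
    by split=> //; rewrite pr_set0 exprn_ge0// invr_ge0 ler0n.
  have [r0 cr0] : exists r, c r != 0.
    apply/existsP; apply: contraNT c0 => /existsPn h; apply/eqP/ffunP => u.
    by rewrite ffunE; apply/eqP; rewrite -[_ == _]negbK.
  have [k /= ck hk] := @arg_maxnP _ r0 (fun r => c r != 0) (fun r => r : nat) cr0.
  have bS : blk k (k + D) (\bigcap_(u < D) [set a : Omega |
      forall m, \sum_r c r * a (r + u)%N ord0 m = 0]) ((q ^ M)%:R^-1 ^+ D).
    apply: blk_iter_shift => u uD.
    rewrite (_ : [set _ | _] = [set a : Omega | a (k + u)%N =
        \row_m (- (c k)^-1 * \sum_(r < K | (r < k)%N) c r * a (r + u)%N ord0 m)]).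
      apply: blk_letter => // a b ab; apply/rowP => m; rewrite !mxE; congr (_ * _).
      by apply: eq_bigr => r rk; rewrite ab// ltn_add2r.
    have E (a : Omega) m : \sum_r c r * a (r + u)%N ord0 m =
        c k * a (k + u)%N ord0 m + \sum_(r < K | (r < k)%N) c r * a (r + u)%N ord0 m.
      rewrite (bigID (fun r : 'I_K => r < k)%N)/= addrC; congr (_ + _).
      rewrite (bigD1 k) ?ltnn//= [X in _ + X]big1 ?addr0// => r /andP[rk nrk].
      case: (altP (c r =P 0)) => [->|/hk]; rewrite ?mul0r//=.
      by move=> kr; case/negP: nrk; rewrite -val_eqE /=; lia.
    apply/seteqP; split=> a /=.
      move=> h; apply/rowP => m; rewrite mxE mulNr -mulrN.
      apply: (mulfI ck); rewrite mulrA divff// mul1r; apply/eqP.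
      by rewrite -addr_eq0 -E h.
    by move=> h m; rewrite E h mxE mulNr mulrN mulrA divff// mul1r addNr.
  split; first by have [_ d _] := bS; exact: determined_measurable d.
  by rewrite (blk_pr bS).
apply: (@le_trans _ _ (pr (\bigcup_c S c))).
  apply: le_pr.
  - exact: determined_measurable (@determined_degenerate K D).
  - by apply: fin_bigcup_measurable => [|v _]; [exact: finite_finset|have [] := S_ub v].
  move=> a [c c0 hc]; exists c => //.
  by rewrite /S (negPf c0).
apply: le_trans (pr_bigcup _ (fun v => (S_ub v).1)) _.
apply: (@le_trans _ _ (\sum_(v : T) (q ^ M)%:R^-1 ^+ D)).
  by apply: ler_sum => v _; have [] := S_ub v.
by rewrite sumr_const mulr_natl card_ffun card_ord.
Qed.

Lemma blk_small_complexity s L t : (L <= s)%N -> exists E : set Omega,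
  blk s (s + t) E ((q ^ M)%:R^-1 ^+ t) /\
  forall a : Omega, lfsr_ok a s L -> E a -> lfsr_ok a (s + t) L.
Proof.
move=> Ls; pose good (a : Omega) (c : {ffun 'I_L -> F}) :=
  `[< forall k, (L <= k < s)%N -> predicts a c k >].
(* The zero register is a default for prefixes that no register of length [L] fits; it keeps the
   probability of the event the same for every prefix. *)
pose c a : {ffun 'I_L -> F} := odflt [ffun=> 0] [pick c | good a c].
exists (\bigcap_(j < t) [set a : Omega | predicts a (c a) (s + j)]); split.
  apply: (@blk_predicts L s t (fun a => c a)) => // a b ab; congr (fun_of_fin (odflt _ _)).
  by apply: eq_pick => d; apply/asboolP/asboolP => h k /[dup] /andP[Lk ks] /h;
    apply: predicts_agree => i ik; rewrite ab// (leq_ltn_trans ik).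
move=> a /lfsr_okP[d hd] Ea; apply/lfsr_okP; exists (c a) => k /andP[Lk kst].
have [ks|sk] := ltnP k s; last first.
  by rewrite -(subnKC sk); apply: Ea; rewrite /= ltn_subLR.
have /asboolP : good a (c a); last by apply; rewrite Lk.
by rewrite /c; case: pickP => // /(_ d)/negP[]; apply/asboolP.
Qed.

(** The event asks that a relation valid on the first K rows, chosen from the first K + D letters,
    hold on t more rows and fail on the next. Then [not_lfsr_ok_relation] applies with L = K + t. *)
Lemma blk_large_complexity (m0 : 'I_M) K D t : exists E : set Omega,
  blk (K + D) (K + D + t.+1) E (q%:R^-1 ^+ t * (1 - q%:R^-1)) /\
  forall a : Omega, ~ degenerate a K D -> E a ->
    ~~ lfsr_ok a (K + D + t.+1) (K + t).
Proof.
pose X v r (a : Omega) :=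
  a (r + D)%N ord0 m0 - \sum_u (v : {ffun 'I_D * 'I_M -> F}) u * a (r + u.1)%N ord0 u.2.
pose good a v := `[< forall r, (r < K)%N -> X v r a = 0 >].
pose v a : {ffun 'I_D * 'I_M -> F} := odflt [ffun=> 0] [pick v | good a v].
pose Z r := [set a : Omega | X (v a) r a = 0].
exists ((\bigcap_(j < t) Z (K + j)) `&` ~` Z (K + t)); split.
  have vab (a b : Omega) : (forall i, (i < K + D)%N -> a i = b i) -> v a = v b.
    move=> ab; congr odflt; apply: eq_pick => d.
    have XE r : (r < K)%N -> X d r a = X d r b.
      move=> rK; rewrite /X ab ?ltn_add2r//; congr (_ - _); apply: eq_bigr => u _.
      by rewrite ab//; have := ltn_ord u.1; lia.
    by apply/asboolP/asboolP => h r rK; rewrite -(h r rK) XE.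
  have bZ j : blk (K + D + j) (K + D + j).+1 (Z (K + j)) (q%:R^-1).
    (* Row K + j of the relation involves only coordinate [m0] of the new letter, so it is a linear
       condition with this indicator as its coefficients. *)
    pose w m : F := (m == m0)%:R.
    rewrite /Z (_ : [set _ | _] = [set a : Omega | \sum_m w m * a (K + D + j)%N ord0 m =
        \sum_u v a u * a (K + j + u.1)%N ord0 u.2]).
      apply: (@blk_linear _ _ _ _ hP _ w m0) => [|a b ab]; first by rewrite /w eqxx oner_neq0.
      rewrite (vab a b) => [|i iKD]; last by rewrite ab// (leq_trans iKD)// leq_addr.
      by apply: eq_bigr => u _; rewrite ab//; have := ltn_ord u.1; lia.
    have wE (a : Omega) : \sum_m w m * a (K + D + j)%N ord0 m = a (K + j + D)%N ord0 m0.
      rewrite (bigD1 m0)//= /w eqxx mul1r big1 ?addr0 ?(addnAC K D)// => m /negPf->.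
      by rewrite mul0r.
    apply/seteqP; split=> a /=; rewrite wE /X => /eqP.
      by rewrite subr_eq0 => /eqP.
    by rewrite -subr_eq0 => /eqP.
  apply: (@blkI _ _ _ _ _ (K + D + t)).
    by apply: blk_iter_shift => j _; exact: bZ.
  by rewrite addnS; exact: blkC.
move=> a nd [Ea nZ].
have gv : good a (v a).
  rewrite /v; case: pickP => //= nog.
  have [d hd] := relation_exists m0 nd.
  by have /negP[] := nog d; apply/asboolP.
rewrite (_ : K + D + t.+1 = (K + t + D).+1)%N; last by lia.
apply: (@not_lfsr_ok_relation _ _ a D (K + t) (v a) m0) => // r rKt.
have [rK|Kr] := ltnP r K; first by move/asboolP: gv => /(_ r rK).
by rewrite -(subnKC Kr); apply: Ea; rewrite /= ltn_subLR.
Qed.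
End Bounds.

(** * Limit superior along geometric windows *)

Lemma limn_esup_eqP (R : realType) (u : nat -> R) (l : R) :
  (forall e : R, 0 < e -> exists N, forall n, (N <= n)%N -> u n <= l + e) ->
  (forall e : R, 0 < e -> forall N, exists2 n, (N <= n)%N & l - e <= u n) ->
  limn_esup (fun n => (u n)%:E) = l%:E.
Proof.
move=> hle hge; apply/eqP; rewrite eq_le; apply/andP; split.
  apply/lee_addgt0Pr => e e0; have [N hN] := hle e e0.
  apply: (@le_trans _ _ (ereal_sup ((fun n => (u n)%:E) @` [set n | (N <= n)%N]))).
    by apply: ereal_inf_lbound; exists [set n | (N <= n)%N] => //; exact: nbhs_infty_ge.
  by apply: ge_ereal_sup => _ [n /= Nn <-]; rewrite -EFinD lee_fin hN.
apply: le_ereal_inf_tmp => _ [V [N _ NV] <-].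
apply/lee_subgt0Pr => e e0; have [n Nn un] := hge e e0 N.
apply: (@le_trans _ _ (u n)%:E); first by rewrite -EFinB lee_fin.
by apply: ereal_sup_ubound; exists n => //; exact: NV.
Qed.

Section LimsupLog.
Variables (R : realType) (q M : nat) (K : nat -> nat) (d : nat -> R).
Hypotheses (q_gt1 : (1 < q)%N) (M_gt0 : (0 < M)%N).
Hypothesis hle : forall b, exists I, forall i, (I <= i)%N -> forall n,
  (q ^ (b.+1 * i) <= n < q ^ (b.+1 * i.+1))%N ->
  M.+1%:R * d n <= (b.+1 * i.+1 + i + 2 * M.+1)%:R.
Hypothesis hge : forall b I, exists2 i, (I <= i)%N & exists2 n,
  (q ^ (M * b.+2 * i) <= n <= K b * q ^ (M * b.+2 * i))%N &
  (M * b.+1 * i)%:R - (M.+1 * i.+2)%:R <= M.+1%:R * d n.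

Let q_gt0 : (0 < q)%N. Proof. exact: ltnW. Qed.
Let lnq_gt0 : 0 < ln (q%:R : R). Proof. by rewrite ln_gt0 // ltr1n. Qed.

Let ln_qX k : ln ((q ^ k)%:R : R) = k%:R * ln q%:R.
Proof. by rewrite natrX lnXn ?ltr0n// mulr_natl. Qed.

Let le_ln_nat m n : (0 < m)%N -> (m <= n)%N -> ln (m%:R : R) <= ln n%:R.
Proof. by move=> m0 mn; rewrite ler_ln ?posrE ?ltr0n ?ler_nat// (leq_trans m0). Qed.

Let i_lt_qX i : (i < q ^ i)%N. Proof. exact: ltn_expl. Qed.

(** Relative to log_q n, [hle] bounds M.+1 * d n by about 1 + 1/(b+1), and [hge] attains about
    (M(b+1) - (M+1)) / (M(b+2)); both tend to 1 as b grows. The factor [K b] only shifts log_q n by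
    a constant. Stated for a general [d] so as to serve the deviation and its negative. *)
Lemma limsup_log : limn_esup (fun n => (d n / ln n%:R)%:E) =
  ((M.+1%:R * ln (q%:R : R))^-1)%:E.
Proof.
set u := ln (q%:R : R); set c := _^-1.
have m0 : (0 : R) < M.+1%:R by rewrite ltr0n.
have cE : c * (M.+1%:R * u) = 1 by rewrite mulVf// gt_eqF// mulr_gt0.
apply: limn_esup_eqP => e e0.
  have de0 : 0 < M.+1%:R * e * u by rewrite !mulr_gt0.
  have [b hb] : exists b : nat, 2 <= M.+1%:R * e * u * b.+1%:R.
    exists (Num.trunc (2 / (M.+1%:R * e * u))).
    by rewrite mulrC -ler_pdivrMr// ltW// truncnS_gt.
  have [I hI] := hle b.
  (* This forces i >= b.+1 + 2 * M.+1, so the constants in [hle] are absorbed by one further i; the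
     total excess 2i is what [b] was chosen for. *)
  exists (q ^ (b.+1 * (I + (b.+1 + 2 * M.+1))))%N => n hn.
  have n0 : (0 < n)%N by apply: leq_trans hn; rewrite expn_gt0 q_gt0.
  pose i := trunc_log (q ^ b.+1) n.
  have qb1 : (1 < q ^ b.+1)%N by rewrite -(exp1n b.+1) ltn_exp2r.
  have hin : (q ^ (b.+1 * i) <= n < q ^ (b.+1 * i.+1))%N.
    by rewrite !expnM; exact: (trunc_log_bounds qb1 n0).
  have Ii : (I + (b.+1 + 2 * M.+1) <= i)%N.
    rewrite leqNgt; apply/negP => iI.
    have : (n < n)%N.
      case/andP: hin => _ /leq_trans; apply; apply: leq_trans hn.
      by rewrite leq_exp2l// leq_mul2l.
    by rewrite ltnn.
  have := hI i _ n hin; have Ii' : (I <= i)%N by lia.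
  move=> /(_ Ii') dn.
  have lnn : b.+1%:R * i%:R * u <= ln n%:R.
    by rewrite -natrM -ln_qX; apply: le_ln_nat; [rewrite expn_gt0 q_gt0|case/andP: hin].
  have i0 : (0 < i)%N by lia.
  have lnn0 : 0 < ln (n%:R : R).
    by apply: lt_le_trans lnn; rewrite !mulr_gt0// ltr0n.
  rewrite ler_pdivrMr// -(ler_pM2l m0) (le_trans dn)//.
  apply: (@le_trans _ _ (M.+1%:R * ((c + e) * (b.+1%:R * i%:R * u)))); last first.
    by rewrite ler_pM2l// ler_pM2l// addr_gt0// invr_gt0 mulr_gt0.
  have -> : M.+1%:R * ((c + e) * (b.+1%:R * i%:R * u)) =
     (c * (M.+1%:R * u)) * (b.+1%:R * i%:R) + M.+1%:R * e * u * b.+1%:R * i%:R by ring.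
  rewrite cE mul1r.
  apply: (@le_trans _ _ (b.+1%:R * i%:R + 2 * i%:R)); last first.
    by rewrite lerD2l ler_wpM2r// ler0n.
  by rewrite -!natrM -natrD ler_nat; lia.
(* For e <= c the factor c - e is nonnegative, so it can multiply the upper bound on ln n. *)
move=> N; wlog ec : e e0 / e <= c.
  move=> h; have [ec|/ltW ce] := leP e c; first exact: h.
  have c0 : 0 < c by rewrite invr_gt0 mulr_gt0.
  have [n Nn hn] := h c c0 (lexx c); exists n => //; apply: le_trans hn.
  by rewrite lerD2l lerN2.
pose dl := e * (M.+1%:R * u).
have dl0 : 0 < dl by rewrite !mulr_gt0.
have ceE : c - e = c * (1 - dl).
  by rewrite /dl mulrBr mulr1 mulrCA cE mulr1.
have dl1 : 0 <= 1 - dl by rewrite subr_ge0 -cE ler_wpM2r// mulr_ge0// ltW.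
(* Per unit of i, M is lost between b.+2 and b.+1 and M + 1 in the error of [hge]; the remaining 1
   absorbs the constants 2 * M.+1 and [kp]. *)
have [b hb] : exists b : nat, (2 * M + 2)%:R <= dl * M%:R * b.+2%:R.
  have dlM : 0 < dl * M%:R by rewrite mulr_gt0// ltr0n.
  exists (Num.trunc ((2 * M + 2)%:R / (dl * M%:R))).
  rewrite mulrC -ler_pdivrMr// ltW//; apply: lt_le_trans (truncnS_gt _) _.
  by rewrite ler_nat.
pose kp : R := ln (K b)%:R / u.
pose Ik := Num.trunc (2 * M.+1%:R + kp).
have [i iI [n /andP[nlo nhi] dn]] := hge b (N + Ik.+1).
have ni : (i <= n)%N.
  apply: leq_trans nlo; apply: leq_trans (ltnW (i_lt_qX i)) _.
  rewrite leq_exp2l//; apply: leq_pmull; rewrite muln_gt0 M_gt0//.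
exists n; first by apply: leq_trans ni; lia.
have i0 : (0 < i)%N by lia.
have n1 : (1 < n)%N.
  apply: leq_trans nlo; rewrite -(expn0 q) ltn_exp2l// !muln_gt0 M_gt0/=; lia.
have K0 : (0 < K b)%N by case: (K b) nhi => //; lia.
have lnn0 : 0 < ln (n%:R : R) by rewrite ln_gt0// ltr1n.
have lnn : ln n%:R <= (kp + M%:R * b.+2%:R * i%:R) * u.
  apply: le_trans (le_ln_nat (ltnW n1) nhi) _.
  rewrite natrM lnM ?posrE ?ltr0n ?expn_gt0 ?q_gt0// ln_qX mulrDl /kp divfK ?gt_eqF//.
  by rewrite -!natrM.
rewrite ler_pdivlMr// -(ler_pM2l m0) (le_trans _ dn)// ceE.
apply: (@le_trans _ _ (M.+1%:R * (c * (1 - dl) * ((kp + M%:R * b.+2%:R * i%:R) * u)))).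
  by rewrite ler_pM2l// ler_wpM2l// mulr_ge0// invr_ge0 mulr_ge0// ltW.
have -> : M.+1%:R * (c * (1 - dl) * ((kp + M%:R * b.+2%:R * i%:R) * u)) =
   (c * (M.+1%:R * u)) * ((1 - dl) * (kp + M%:R * b.+2%:R * i%:R)) by ring.
rewrite cE mul1r.
have kp0 : 0 <= kp by rewrite divr_ge0 ?ln_ge0 ?ler1n// ltW.
have ik : 2 * M.+1%:R + kp <= i%:R.
  apply: le_trans (ltW (truncnS_gt _)) _; rewrite ler_nat -/Ik; lia.
have hbi : (2 * M + 2)%:R * i%:R <= dl * M%:R * b.+2%:R * i%:R.
  by rewrite ler_wpM2r// ler0n.
have dkp : 0 <= dl * kp by rewrite mulr_ge0// ltW.
have S1 m : m.+1%:R = m%:R + 1 :> R by rewrite -natr1.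
rewrite ?natrM ?natrD ?natrM in hbi *; rewrite ?S1 in hbi ik dl0 dl1 dkp *.
nra.
Qed.
End LimsupLog.

(** * Almost sure bounds *)

Lemma ceil_frac_ge M n : (n * M <= M.+1 * ceil_frac M n)%N.
Proof. by rewrite /ceil_frac; lia. Qed.

Lemma ceil_frac_le M n : (M.+1 * ceil_frac M n <= n * M + M)%N.
Proof. by rewrite /ceil_frac; lia. Qed.

Section Tails.
Variables (R : realType) (F : finFieldType) (M : nat).
Local Notation A := 'rV[F]_M.
Local Notation Omega := (seqspace F M).
Variable P : probability Omega R.
Hypothesis hP : forall w : seq A,
  P (cylinder w) = ((#|F| ^ (M * size w))%:R^-1)%:E.
Local Notation pr := (pr P).
Local Notation blk := (blk P).
Local Notation q := #|F|.

Lemma card_F_gt1 : (1 < q)%N.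
Proof. by rewrite finNzRing_gt1. Qed.

Lemma lin_comp_le (a : Omega) n : (lin_comp a n <= n)%N.
Proof.
rewrite -lfsr_ok_lin_comp; apply/lfsr_okP; exists [ffun=> 0] => k.
by case/andP=> nk; rewrite ltnNge nk.
Qed.

Lemma lin_comp_agree (a b : Omega) n : (forall i, (i < n)%N -> a i = b i) ->
  lin_comp a n = lin_comp b n.
Proof.
move=> ab; apply/eqP; rewrite eqn_leq -!lfsr_ok_lin_comp.
by apply/andP; split; [apply: (@lfsr_ok_agree _ _ b a) => [i /ab//|]|
  apply: (@lfsr_ok_agree _ _ a b) => //]; rewrite lfsr_ok_lin_comp.
Qed.

Let qX_gt0 m : (0 : R) < (q ^ m)%:R.
Proof. by rewrite ltr0n expn_gt0 card_F_gt0. Qed.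

Let qX_quotient x y z : (x + z <= y)%N ->
  (q ^ x)%:R * (q ^ y)%:R^-1 <= (q ^ z)%:R^-1 :> R.
Proof.
move=> xzy; rewrite ler_pdivrMr// mulrC ler_pdivlMr// -natrM -expnD ler_nat.
by rewrite leq_exp2l ?card_F_gt1.
Qed.

(** For L = ceil_frac M n + k, the exponent M(n - L) - L = nM - (M+1)L is at most -(M+1)k. *)
Lemma pr_lin_comp_gt n k :
  pr [set a : Omega | (ceil_frac M n + k < lin_comp a n)%N] <= (q ^ (M.+1 * k))%:R^-1.
Proof.
have [Ln|nL] := leqP (ceil_frac M n + k) n; last first.
  rewrite (_ : [set _ | _] = set0) ?pr_set0 ?invr_ge0 ?ler0n//.
  apply/seteqP; split=> a //=; have := lin_comp_le a n; lia.
rewrite (_ : [set _ | _] = [set a : Omega | ~~ lfsr_ok a n (ceil_frac M n + k)]).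
  apply: le_trans (pr_not_lfsr_ok hP Ln) _.
  rewrite exprVn -natrX; apply: qX_quotient.
  have := ceil_frac_ge M n; nia.
by apply/seteqP; split=> a /=; rewrite lfsr_ok_lin_comp ltnNge.
Qed.

(** For L = floor(nM/(M+1)) - k, the exponent L - M(n - L) = (M+1)L - nM is at most -(M+1)k. *)
Lemma pr_lin_comp_lt n k :
  pr [set a : Omega | (M.+1 * (lin_comp a n + k) <= n * M)%N] <= (q ^ (M.+1 * k))%:R^-1.
Proof.
have [kL|Lk] := leqP (M.+1 * k) (n * M); last first.
  rewrite (_ : [set _ | _] = set0) ?pr_set0 ?invr_ge0 ?ler0n//.
  by apply/seteqP; split=> a //=; nia.
have Ln : (n * M %/ M.+1 - k <= n)%N by nia.
rewrite (_ : [set _ | _] = [set a : Omega | lfsr_ok a n (n * M %/ M.+1 - k)]).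
  apply: le_trans (pr_lfsr_ok hP Ln) _.
  rewrite exprVn -natrX -expnM; apply: qX_quotient.
  have : (M.+1 * (n * M %/ M.+1) <= n * M)%N by lia.
  have : (k <= n * M %/ M.+1)%N by rewrite leq_divRL// mulnC.
  nia.
apply/seteqP; split=> a /=; rewrite lfsr_ok_lin_comp => h.
  by rewrite leq_subRL -?(leq_divRL _ _ (ltn0Sn M)); rewrite ?leq_divRL// mulnC// addnC.
have : (lin_comp a n + k <= n * M %/ M.+1)%N.
  have : (k <= n * M %/ M.+1)%N by rewrite leq_divRL// mulnC.
  lia.
by rewrite leq_divRL// mulnC.
Qed.

(* The windows q^(bi) <= n < q^(b(i+1)) are short enough on the logarithmic scale for
   one threshold k per window, and a union bound over a window costs only q^(-i). *)
Lemma ae_deviation_bound b : {ae P, forall a : Omega, exists I, forall i, (I <= i)%N ->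
  forall n, (q ^ (b * i) <= n < q ^ (b * i.+1))%N ->
  (M.+1 * lin_comp a n <= M.+1 * ceil_frac M n + (b * i.+1 + i + M.+1) /\
   M.+1 * ceil_frac M n <= M.+1 * lin_comp a n + (b * i.+1 + i + 2 * M.+1))%N}.
Proof.
(* M.+1 * k i exceeds [T i]: the part b * i.+1 pays for the number of indices in the union, and the
   part i leaves the summable factor q^(-i). *)
pose T i := (b * i.+1 + i)%N; pose k i := (T i %/ M.+1).+1.
pose U n m := [set a : Omega | (ceil_frac M n + m < lin_comp a n)%N] `|`
              [set a : Omega | (M.+1 * (lin_comp a n + m) <= n * M)%N].
pose B i := \bigcup_(n : 'I_(q ^ (b * i.+1))) U n (k i).
have dU n m : determined n (U n m).
  move=> a c ac; have := lin_comp_agree ac; rewrite /U /= => ->.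
  by [].
have mU n m : measurable (U n m) by exact: determined_measurable (@dU n m).
have mB i : measurable (B i).
  by apply: fin_bigcup_measurable => [|n _]; [exact: finite_finset|exact: mU].
have prU n m : pr (U n m) <= 2 * (q ^ (M.+1 * m))%:R^-1.
  apply: (@le_trans _ _ (pr [set a : Omega | (ceil_frac M n + m < lin_comp a n)%N] +
    pr [set a : Omega | (M.+1 * (lin_comp a n + m) <= n * M)%N])).
    rewrite -lee_fin EFinD -!pr_EFin//.
    - apply: measureU2.
      + by apply: (@determined_measurable _ _ n) => a c ac /=; rewrite (lin_comp_agree ac).
      + by apply: (@determined_measurable _ _ n) => a c ac /=; rewrite (lin_comp_agree ac).
    - by apply: (@determined_measurable _ _ n) => a c ac /=; rewrite (lin_comp_agree ac).
    - by apply: (@determined_measurable _ _ n) => a c ac /=; rewrite (lin_comp_agree ac).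
  by rewrite mulr_natl mulr2n lerD// ?pr_lin_comp_gt ?pr_lin_comp_lt.
have prB i : pr (B i) <= 4 / (2 ^ i.+1)%:R.
  apply: (le_trans (pr_bigcup P (fun n : 'I_(q ^ (b * i.+1)) => mU n (k i)))).
  apply: (@le_trans _ _ (\sum_(n < q ^ (b * i.+1)) 2 * (q ^ (M.+1 * k i))%:R^-1)).
    exact: ler_sum.
  rewrite sumr_const card_ord -[_ *+ (_ ^ _)]mulr_natl mulrCA.
  apply: (@le_trans _ _ (2 * (q ^ i)%:R^-1)).
    rewrite ler_wpM2l//; apply: qX_quotient; rewrite /k.
    rewrite -/(T i) mulnS; have : (T i < M.+1 * (T i %/ M.+1) + M.+1)%N.
      by rewrite -mulnSr mulnC; exact: ltn_ceil.
    by rewrite addnC => /ltnW.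
  rewrite (_ : 4 = 2 * 2 :> R); last by ring.
  rewrite expnS natrM invfM mulrA mulfK ?pnatr_eq0// ler_wpM2l//.
  rewrite lef_pV2 ?posrE ?ltr0n ?expn_gt0 ?card_F_gt0// ler_nat.
  by case: (i) => // j; rewrite leq_exp2r// card_F_gt1.
have lim0 : P (lim_sup_set B) = 0%E.
  apply: lim_sup_set_cvg0 => //.
  apply: (@le_lt_trans _ _ (\sum_(i <oo) (4 / (2 ^ i.+1)%:R)%:E)%E).
    by apply: lee_nneseries => // i _; have := prB i; rewrite -lee_fin -pr_EFin.
  apply: le_lt_trans (epsilon_trick0 xpredT _) _ => //.
  by rewrite ltry.
exists (lim_sup_set B); split => //.
  by apply: bigcapT_measurable => n; apply: bigcup_measurable => j _; exact: mB.
move=> a; apply: contra_notP => /existsNP[I /not_implyP[_ hI]].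
exists I => i Ii n /andP[_ nlt].
have nU : ~ U n (k i) a.
  by move=> Ua; apply: hI; exists i => //; exists (Ordinal nlt).
have kT : (M.+1 * k i <= T i + M.+1)%N by rewrite /k; lia.
split.
  have : (lin_comp a n <= ceil_frac M n + k i)%N.
    by rewrite leqNgt; apply/negP => h; apply: nU; left.
  by move: kT; rewrite /T; nia.
have : (n * M < M.+1 * (lin_comp a n + k i))%N.
  by rewrite ltnNge; apply/negP => h; apply: nU; right.
by have := ceil_frac_le M n; move: kT; rewrite /T; nia.
Qed.

Lemma ae_infinitely_often (W : nat -> set Omega) :
  (forall i, measurable (W i)) ->
  (forall i, (0 < i)%N -> pr (~` W i) <= 3 / i.+1%:R) ->
  {ae P, forall a : Omega, forall I, exists2 i, (I <= i)%N & W i a}.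
Proof.
move=> mW hW; apply/ae_foralln => I.
pose Z := \bigcap_(i in [set i | (I <= i)%N]) ~` W i.
have mZ : measurable Z.
  by apply: bigcap_measurableType => i _; exact: measurableC (mW i).
exists Z; split=> //; last first.
  by move=> a h i Ii Wi; apply: h; exists i.
apply: (etrans (pr_EFin P mZ)); congr (_%:E); apply/eqP; rewrite eq_le pr_ge0 andbT.
apply/ler_addgt0Pr => e e0; rewrite add0r.
pose i := (I + (Num.trunc (3 / e)).+1)%N.
apply: (@le_trans _ _ (pr (~` W i))).
  by apply: le_pr => //; [exact: measurableC (mW i)|move=> a Za; exact: (Za i (leq_addr _ _))].
have i0 : (0 < i)%N by rewrite /i addnS.
apply: le_trans (hW i i0) _; rewrite ler_pdivrMr ?ltr0n// mulrC -ler_pdivrMr//.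
by apply: le_trans (ltW (truncnS_gt _)) _; rewrite ler_nat; exact: leqW (leq_addl _ _).
Qed.

Lemma window_exists (t : nat -> nat) (G : nat -> set Omega) (C : nat -> Omega -> Prop)
    p g J : 0 <= p ->
  (forall j, (j < J)%N -> exists E, blk (t j) (t j.+1) E p /\
     forall a, G j a -> E a -> C j a) ->
  (forall j, (j < J)%N -> determined (t j) (G j)) ->
  (forall j, (j < J)%N -> pr (~` G j) <= g) ->
  exists W, [/\ measurable W, pr (~` W) <= (1 - p) ^+ J + J%:R * (p * g) &
    forall a, W a -> exists2 j, (j < J)%N & C j a].
Proof.
move=> p0 hE dG hG.
have /choice[E {}hE] : forall j, exists E, (j < J)%N -> blk (t j) (t j.+1) E p /\
     forall a, G j a -> E a -> C j a.
  by move=> j; have [/hE[E]|_] := ltnP j J; [exists E|exists setT].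
have bE j : (j < J)%N -> blk (t j) (t j.+1) (E j) p by case/hE.
exists (\bigcup_(j < J) (E j `&` G j)); split.
- apply: bigcup_measurable => j /= jJ; have [_ dE _] := bE j jJ.
  apply: measurableI; first exact: determined_measurable dE.
  exact: determined_measurable (dG j jJ).
- by rewrite setC_bigcup; exact: (blk_window p0 bE dG hG).
- by move=> a [j /= jJ [Ea Ga]]; exists j => //; have [_ h] := hE j jJ; exact: h.
Qed.

(** With J = i q^T attempts, J p lies between i/2 and i. Since (1 - p)(1 + p) <= 1, Bernoulli's
    inequality gives (1 - p)^J <= 1/(1 + J p) <= 2/(i+1); the other term is at most i q^(-(M+1)i) <=
    1/(i+1). *)
Lemma window_bound i T (p g : R) : (0 < M)%N -> (0 < i)%N ->
  (q ^ T)%:R^-1 / 2 <= p -> p <= (q ^ T)%:R^-1 ->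
  0 <= g -> g <= (q ^ (M.+1 * i))%:R^-1 ->
  (1 - p) ^+ (i * q ^ T) + (i * q ^ T)%:R * (p * g) <= 3 / i.+1%:R.
Proof.
move=> M_gt0 i0 plo phi g0 ghi; set J := (i * q ^ T)%N.
have qT0 : (0 : R) < (q ^ T)%:R := qX_gt0 T.
have iq0 : (0 : R) < (q ^ T)%:R^-1 by rewrite invr_gt0.
have p0 : 0 < p by apply: lt_le_trans plo; rewrite divr_gt0.
have p1 : p <= 1.
  by apply: le_trans phi _; rewrite invf_le1// ler1n expn_gt0 card_F_gt0.
have Jlo : i%:R / 2 <= J%:R * p.
  apply: le_trans (_ : J%:R * ((q ^ T)%:R^-1 / 2) <= _); last by rewrite ler_wpM2l.
  by rewrite natrM mulrA mulfK// gt_eqF.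
have Jhi : J%:R * p <= i%:R.
  apply: (@le_trans _ _ (J%:R * (q ^ T)%:R^-1)); first by rewrite ler_wpM2l.
  by rewrite natrM mulfK// gt_eqF.
have bern (x : R) n : 0 <= x -> 1 + n%:R * x <= (1 + x) ^+ n.
  move=> x0; elim: n => [|n IH]; first by rewrite mul0r addr0 expr0.
  rewrite exprS; apply: (@le_trans _ _ ((1 + x) * (1 + n%:R * x))).
    rewrite -natr1; have : 0 <= n%:R * x * x by rewrite !mulr_ge0.
    lra.
  by rewrite ler_wpM2l// addr_ge0.
have one : (1 - p) ^+ J <= 2 / i.+1%:R.
  rewrite ler_pdivlMr ?ltr0n//.
  have pJ0 : 0 <= (1 - p) ^+ J by rewrite exprn_ge0// subr_ge0.
  have le1 : (1 - p) ^+ J * (1 + p) ^+ J <= 1.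
    rewrite -exprMn; apply: exprn_ile1; first by rewrite mulr_ge0 ?subr_ge0// addr_ge0// ltW.
    have : 0 <= p ^+ 2 by exact: sqr_ge0.
    by rewrite expr2; lra.
  have := bern p J (ltW p0) => hb.
  have {hb} := le_trans (ler_wpM2l pJ0 hb) le1.
  have : (1 - p) ^+ J * (1 + i%:R / 2) <= (1 - p) ^+ J * (1 + J%:R * p).
    by rewrite ler_wpM2l// lerD2l.
  rewrite -[i.+1%:R]natr1; move: pJ0; move: (_ ^+ J) => X X0 h1 h2.
  have := le_trans h1 h2; lra.
have two : J%:R * (p * g) <= 1 / i.+1%:R.
  rewrite mulrA; apply: (@le_trans _ _ (i%:R * (q ^ (M.+1 * i))%:R^-1)).
    by apply: ler_pM => //; rewrite mulr_ge0// ltW.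
  rewrite ler_pdivlMr ?ltr0n// -mulrA mulrC -mulrA.
  rewrite mulrC ler_pdivrMr// mul1r -natrM ler_nat.
  have h : (i.+1 <= q ^ i)%N by apply: ltn_expl; exact: card_F_gt1.
  apply: (@leq_trans (q ^ i * q ^ i)); first by apply: leq_mul => //; exact: ltnW.
  by rewrite -expnD leq_exp2l ?card_F_gt1//; nia.
have -> : 3 / i.+1%:R = 2 / i.+1%:R + 1 / i.+1%:R :> R.
  by rewrite -mulrDl; congr (_ / _); ring.
exact: lerD.
Qed.
End Tails.

(** * Extreme deviations infinitely often *)

Section Extremes.
Variables (R : realType) (F : finFieldType) (M : nat).
Local Notation A := 'rV[F]_M.
Local Notation Omega := (seqspace F M).
Variable P : probability Omega R.
Hypothesis hP : forall w : seq A,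
  P (cylinder w) = ((#|F| ^ (M * size w))%:R^-1)%:E.
Hypothesis M_gt0 : (0 < M)%N.
Local Notation pr := (pr P).
Local Notation blk := (blk P).
Local Notation q := #|F|.

Let q_gt1 : (1 < q)%N := card_F_gt1 F.
Let q_gt0 : (0 < q)%N := ltnW q_gt1.

Lemma ae_windows (Q : nat -> Omega -> Prop) :
  (forall i, (0 < i)%N -> exists W, [/\ measurable W, pr (~` W) <= 3 / i.+1%:R &
    forall a, W a -> Q i a]) ->
  {ae P, forall a : Omega, forall I, exists2 i, (I <= i)%N & Q i a}.
Proof.
move=> hQ.
have /choice[W hW] : forall i, exists W, measurable W /\ ((0 < i)%N ->
    pr (~` W) <= 3 / i.+1%:R /\ forall a, W a -> Q i a).
  move=> [|i]; first by exists setT; split.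
  by have [W [mW pW WQ]] := hQ i.+1 isT; exists W.
have mW i : measurable (W i) by have [] := hW i.
have pW i : (0 < i)%N -> pr (~` W i) <= 3 / i.+1%:R by case: (hW i) => _ /[apply] -[].
apply: filterS (ae_infinitely_often mW pW) => a h I.
(* Asking for i > I rules out i = 0, for which the window is a dummy. *)
have [i Ii Wi] := h I.+1; exists i; first exact: ltnW.
by have [_ /(_ (leq_ltn_trans (leq0n _) Ii))[_]] := hW i; apply.
Qed.

(** The attempts occupy at most M(b+2) i^2 q^(M(b+1)i) letters, and i^2 <= 2 * 2^i <= 2 q^i. All of
    them thus end within a constant factor of the starting time, invisible on the logarithmic
    scale. *)
Lemma window_fits b i j tau : (0 < i)%N -> (tau <= M * b.+2 * i)%N ->
  (j < i * q ^ (M * b.+1 * i))%N ->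
  (q ^ (M * b.+2 * i) + j * tau + tau <=
   (1 + 2 * (M * b.+2)) * q ^ (M * b.+2 * i))%N.
Proof.
move=> i0 htau jJ.
have ii : (i * i <= 2 * 2 ^ i)%N.
  elim: (i) => // m IH; have : (m < 2 ^ m)%N by exact: ltn_expl.
  by rewrite expnS; lia.
have h1 : (j * tau + tau <= i * q ^ (M * b.+1 * i) * (M * b.+2 * i))%N.
  by rewrite addnC -mulSn leq_mul.
have h2 : (2 ^ i * q ^ (M * b.+1 * i) <= q ^ (M * b.+2 * i))%N.
  apply: (@leq_trans (q ^ i * q ^ (M * b.+1 * i))).
    by rewrite leq_mul2r; apply/orP; right; rewrite leq_exp2r.
  by rewrite -expnD leq_exp2l//; nia.
rewrite mulnDl mul1n -addnA leq_add2l (leq_trans h1)//.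
have h3 : (i * i * q ^ (M * b.+1 * i) <= 2 * q ^ (M * b.+2 * i))%N.
  apply: (@leq_trans (2 * 2 ^ i * q ^ (M * b.+1 * i))); first by rewrite leq_mul2r ii orbT.
  by rewrite -mulnA leq_mul2l h2.
by have := leq_mul (leqnn (M * b.+2)%N) h3; lia.
Qed.

Lemma window_start_ge b i : (0 < i)%N -> (3 * (M * i) < q ^ (M * b.+2 * i))%N.
Proof.
move=> i0; apply: (@leq_trans (q ^ (M * i) * q ^ (M * i))).
  have := ltn_expl (M * i) q_gt1; have : (0 < M * i)%N by rewrite muln_gt0 M_gt0.
  by move: (q ^ _)%N => x; nia.
by rewrite -expnD leq_exp2l//; nia.
Qed.

(** Before each attempt the complexity is typically at most [ceil_frac] + i. A successful attempt
    keeps that bound for [tau] letters, at cost q^(-M tau) = q^(-T), while (M+1) times [ceil_frac]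
    grows by M tau up to rounding. *)
Lemma ae_small_lin_comp b : {ae P, forall a : Omega, forall I, exists2 i, (I <= i)%N &
  exists2 n, (q ^ (M * b.+2 * i) <= n <= (1 + 2 * (M * b.+2)) * q ^ (M * b.+2 * i))%N &
    (M.+1 * lin_comp a n + M * b.+1 * i <= M.+1 * ceil_frac M n + M.+1 * i.+2)%N}.
Proof.
apply: ae_windows => i i0; set N := (q ^ (M * b.+2 * i))%N.
pose T := (M * b.+1 * i)%N; pose tau := (b.+1 * i)%N; pose t j := (N + j * tau)%N.
have hN := window_start_ge b i0.
pose G j := [set a : Omega | lfsr_ok a (t j) (ceil_frac M (t j) + i)].
pose C j (a : Omega) := (lin_comp a (t j + tau) <= ceil_frac M (t j) + i)%N.
pose p : R := (q ^ T)%:R^-1; pose g : R := (q ^ (M.+1 * i))%:R^-1.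
have p0 : 0 <= p by rewrite invr_ge0.
have [W [mW pW WC]] : exists W, [/\ measurable W,
    pr (~` W) <= (1 - p) ^+ (i * q ^ T) + (i * q ^ T)%:R * (p * g) &
    forall a, W a -> exists2 j, (j < i * q ^ T)%N & C j a].
  apply: (@window_exists _ _ _ P t G C) => // j jJ.
  - have Lt : (ceil_frac M (t j) + i <= t j)%N.
      have := ceil_frac_le M (t j); have : (N <= t j)%N by rewrite leq_addr.
      rewrite -/N in hN; nia.
    have [E [bE hE]] := blk_small_complexity hP tau Lt.
    exists E; split; last by move=> a Ga Ea; rewrite /C -lfsr_ok_lin_comp; exact: hE.
    rewrite /t mulSn addnCA [(tau + _)%N]addnC.
    by move: bE; rewrite exprVn -natrX -expnM mulnA.
  - exact: determined_lfsr_ok.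
  - rewrite (_ : ~` G j = [set a : Omega | (ceil_frac M (t j) + i < lin_comp a (t j))%N]).
      exact: pr_lin_comp_gt.
    by apply/seteqP; split=> a; rewrite /G /= lfsr_ok_lin_comp ltnNge => /negP.
exists W; split=> //.
  apply: le_trans pW _; apply: (window_bound (M := M)) => //.
  - by rewrite ler_pdivrMr// ler_peMr// ler1n.
  - by rewrite invr_ge0.
move=> a /WC[j jJ Cj]; exists (t j + tau)%N.
  apply/andP; split; first by rewrite /t -addnA leq_addr.
  by apply: window_fits => //; rewrite /tau; nia.
have := ceil_frac_le M (t j); have := ceil_frac_ge M (t j + tau).
by move: Cj; rewrite /C /tau; nia.
Qed.

Lemma ae_large_lin_comp b : {ae P, forall a : Omega, forall I, exists2 i, (I <= i)%N &
  exists2 n, (q ^ (M * b.+2 * i) <= n <= (1 + 2 * (M * b.+2)) * q ^ (M * b.+2 * i))%N &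
    (M.+1 * ceil_frac M n + M * b.+1 * i <= M.+1 * lin_comp a n + M.+1 * i.+2)%N}.
Proof.
apply: ae_windows => i i0; set N := (q ^ (M * b.+2 * i))%N.
pose T := (M * b.+1 * i)%N; pose t j := (N + j * T.+1)%N.
have hN := window_start_ge b i0.
(* The margin i.+1 makes M D - K = (M+1)D - t at least (M+1)i, so degeneracy has probability at most
   [g]; it lowers the resulting complexity bound by only i + O(1). *)
pose D j := (t j %/ M.+1 + i.+1)%N; pose K j := (t j - D j)%N.
have DM j : (M.+1 * (t j %/ M.+1) <= t j < M.+1 * (t j %/ M.+1) + M.+1)%N by lia.
have KD j : (K j + D j = t j)%N.
  rewrite subnK// /D; have : (N <= t j)%N by rewrite leq_addr.
  by have := DM j; rewrite -/N in hN; nia.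
pose G j := ~` [set a : Omega | degenerate a (K j) (D j)].
pose C j (a : Omega) := (K j + T < lin_comp a (t j + T.+1))%N.
pose p : R := q%:R^-1 ^+ T * (1 - q%:R^-1); pose g : R := (q ^ (M.+1 * i))%:R^-1.
have q0 : (0 : R) < q%:R by rewrite ltr0n.
(* Hence the breaking factor 1 - 1/q is at least 1/2, the loss allowed in [window_bound]. *)
have qV : (q%:R^-1 : R) <= 2^-1 by rewrite lef_pV2 ?posrE// ler_nat.
have qV0 : 0 <= (q%:R^-1 : R) by rewrite invr_ge0 ltW.
have p0 : 0 <= p by rewrite mulr_ge0 ?exprn_ge0//; lra.
have [W [mW pW WC]] : exists W, [/\ measurable W,
    pr (~` W) <= (1 - p) ^+ (i * q ^ T) + (i * q ^ T)%:R * (p * g) &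
    forall a, W a -> exists2 j, (j < i * q ^ T)%N & C j a].
  apply: (@window_exists _ _ _ P t G C) => // j jJ.
  - have [E [bE hE]] := blk_large_complexity hP (Ordinal M_gt0) (K j) (D j) T.
    rewrite KD in bE hE; exists E; split.
      by rewrite {2}/t mulSn addnCA [(T.+1 + _)%N]addnC.
    by move=> a Ga Ea; rewrite /C ltnNge -lfsr_ok_lin_comp; exact: hE.
  - by rewrite -(KD j); apply: determinedC; exact: determined_degenerate.
  - rewrite /G setCK; apply: le_trans (pr_degenerate hP _ _) _.
    rewrite exprVn -natrX -expnM ler_pdivrMr ?ltr0n ?expn_gt0 ?q_gt0// mulrC.
    rewrite ler_pdivlMr ?ltr0n ?expn_gt0 ?q_gt0// -natrM -expnD ler_nat leq_exp2l//.
    by have := KD j; have := DM j; rewrite /D; nia.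
exists W; split=> //.
  apply: le_trans pW _; apply: (window_bound (M := M)) => //.
  - by rewrite /p exprVn -natrX ler_wpM2l ?invr_ge0//; lra.
  - by rewrite /p exprVn -natrX ler_piMr ?invr_ge0//; lra.
  - by rewrite invr_ge0.
move=> a /WC[j jJ Cj]; exists (t j + T.+1)%N.
  apply/andP; split; first by rewrite /t -addnA leq_addr.
  by apply: window_fits => //; rewrite /T; nia.
have := ceil_frac_le M (t j + T.+1); have := KD j; have := DM j.
by move: Cj; rewrite /C /D -/T; nia.
Qed.
End Extremes.

End LinearComplexityDeviation.

(** * Assembly of the two limits *)

Local Open Scope ereal_scope.

Theorem mainTheorem14 (R : realType) (F : finFieldType) (M : nat)
  (hM : (0 < M)%N)
  (P : probability (seqspace F M) R)
  (hP : forall w : seq 'rV[F]_M,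
      P (cylinder w) = ((#|F| ^ (M * size w))%:R^-1)%:E) :
  {ae P, forall a : seqspace F M,
     limn_esup (fun n => (lc_dev R a n / ln n%:R)%:E)
       = ((M.+1%:R * ln #|F|%:R)^-1)%:E /\
     limn_einf (fun n => (lc_dev R a n / ln n%:R)%:E)
       = (- (M.+1%:R * ln #|F|%:R)^-1)%:E}.
Proof.
have hA := ae_foralln (fun b => ae_deviation_bound hP b.+1).
have hB := ae_foralln (fun b => ae_large_lin_comp hP hM b).
have hC := ae_foralln (fun b => ae_small_lin_comp hP hM b).
move: hA hB hC; apply: filterS3 => a hA hB hC.
have q1 := card_F_gt1 F.
have devE n : (M.+1%:R * lc_dev R a n =
    (M.+1 * lin_comp a n)%:R - (M.+1 * ceil_frac M n)%:R :> R)%R.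
  by rewrite /lc_dev mulrBr -!natrM.
split.
  apply: (@limsup_log R #|F| M (fun b => 1 + 2 * (M * b.+2))%N) => // [b|b I].
    have [I hI] := hA b; exists I => i Ii n hn.
    have [h1 h2] := hI i Ii n hn.
    by rewrite devE lerBlDl -natrD ler_nat; lia.
  have [i Ii [n hn h]] := hB b I; exists i => //; exists n => //.
  by rewrite devE lerBlDr addrAC lerBrDr -!natrD ler_nat addnC.
(* The lower limit is minus the upper limit of the negated deviation, so [limsup_log] is applied
   again, now with the small-complexity windows. *)
rewrite /limn_einf (_ : (fun n => _) = (fun n => ((- lc_dev R a n / ln n%:R)%R)%:E)); last first.
  by apply/funext => n; rewrite /= mulNr EFinN.
rewrite EFinN; congr (- _).
apply: (@limsup_log R #|F| M (fun b => 1 + 2 * (M * b.+2))%N) => // [b|b I].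
  have [I hI] := hA b; exists I => i Ii n hn.
  have [h1 h2] := hI i Ii n hn.
  by rewrite mulrN devE opprB lerBlDl -natrD ler_nat; lia.
have [i Ii [n hn h]] := hC b I; exists i => //; exists n => //.
by rewrite mulrN devE opprB lerBlDr addrAC lerBrDr -!natrD ler_nat addnC.
Qed.
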